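(* Let $G$ be a finite group of order $n$. If $G$ is nilpotent or $n$ is odd, then $$|E(C(G)^* )|\geq|E(C(\mathbb{Z}_n)^* )|.$$ Moreover, (for such $G$) equality holds if and only if $G\cong\mathbb{Z}_n$.
   Context: For a finite group $G$, $C(G)$ denotes the poset (under inclusion) of all cyclic subgroups of $G$, including the trivial subgroup. The cyclic subgroup graph $C(G)^*$ is the simple undirected graph with vertex set $C(G)$ in which two distinct vertices $H_1,H_2$ are joined by an edge if and only if, up to swapping them, $H_1< H_2$ and there is no cyclic subgroup $K$ of $G$ with $H_1<K<H_2$; that is, $C(G)^*$ is the Hasse diagram of $C(G)$ viewed as a simple undirected graph. $E(C(G)^* )$ denotes its set of edges. $\mathbb{Z}_n$ denotes the cyclic group of order $n$. *)

(* Defs.v *)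
From mathcomp Require Import all_boot all_fingroup all_solvable.
From mathcomp Require Import zmodp.

Set Implicit Arguments.
Unset Strict Implicit.
Unset Printing Implicit Defensive.

Local Open Scope group_scope.

Definition cyclic_subgroups (gT : finGroupType) (G : {group gT}) :
    {set {group gT}} :=
  [set H in subgroups G | cyclic H].

Definition cyclic_cover (gT : finGroupType) (G : {group gT}) :
    rel {group gT} :=
  fun H1 H2 => [&& H1 \in cyclic_subgroups G, H2 \in cyclic_subgroups G,
    H1 \proper H2
    & ~~ [exists K : {group gT} in cyclic_subgroups G,
            (H1 \proper K) && (K \proper H2)]].

Definition cyclic_adj (gT : finGroupType) (G : {group gT}) :
    rel {group gT} :=
  fun H1 H2 => cyclic_cover G H1 H2 || cyclic_cover G H2 H1.

(* Edges are unordered pairs of vertices, so each is counted once. *)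
Definition cyclic_edges (gT : finGroupType) (G : {group gT}) :
    {set {set {group gT}}} :=
  [set [set H1; H2] | H1 in cyclic_subgroups G, H2 in cyclic_subgroups G
                    & cyclic_adj G H1 H2].

(* Main.v *)
Require Import Defs.
From mathcomp Require Import all_boot all_fingroup all_solvable.
From mathcomp Require Import zmodp.
From mathcomp Require Import zify.

(* Each edge joins a cyclic subgroup K to one of its maximal subgroups, and K
   has one of these for each prime divisor of its order; so the number of edges
   is the sum of omega(|K|) over the cyclic K <= G, and the sum of omega(d) over
   d | n when G is cyclic.

   The comparison removes primes from the smallest p upwards.  Splitting K into
   its p-part Y and its p'-part, which lies in C_G(Y), reduces it to bounding
   from below, for N the part of n prime to p and to all smaller primes and
   p^e = |G|_p, the sum over the cyclic p-subgroups Y <> 1 of the divisor sums of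
   the corresponding part N_Y of |C_G(Y)| by e times the divisor sum of N.  As
   |Aut Y| has no prime factor above p, N / N_Y divides the number of conjugates
   of Y, and for odd n these conjugates more than pay for the divisors of N
   missed by N_Y (in a nilpotent group N_Y = N).  If p^e is not the order of an
   element, Frobenius' theorem on the solutions of x^(p^i) = 1 provides a level
   with enough cyclic subgroups of order p^i to pay for the missing levels. *)

Set Implicit Arguments.
Unset Strict Implicit.
Unset Printing Implicit Defensive.

(** * Comparison of sums along injections *)

Lemma leq_sum_inj (I J : eqType) (r : seq I) (s : seq J) (h : I -> J)
    (F : I -> nat) (H : J -> nat) :
  uniq r -> uniq s -> {in r &, injective h} ->
  {in r, forall i, h i \in s} -> {in r, forall i, F i <= H (h i)} ->
  \sum_(i <- r) F i <= \sum_(j <- s) H j.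
Proof.
move=> Ur Us h_inj h_s leFH.
apply: (@leq_trans (\sum_(j <- map h r) H j)).
  by rewrite big_map big_seq [leqRHS]big_seq; apply: leq_sum.
apply: uniq_sub_le_big => //.
- by move=> x y; apply: leq_addr.
- by rewrite map_inj_in_uniq.
by move=> _ /mapP[i ri ->]; apply: h_s.
Qed.

Lemma leq_sum_inj_fin (I J : finType) (P : pred I) (Q : pred J) (h : I -> J)
    (F : I -> nat) (H : J -> nat) :
  {in P &, injective h} -> (forall i, P i -> Q (h i)) ->
  (forall i, P i -> F i <= H (h i)) ->
  \sum_(i | P i) F i <= \sum_(j | Q j) H j.
Proof.
move=> h_inj hPQ leFH; rewrite -big_filter -[leqRHS]big_filter.
apply: (leq_sum_inj (h := h)); rewrite ?filter_uniq ?index_enum_uniq //.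
- by move=> x y; rewrite !mem_filter => /andP[Px _] /andP[Py _]; apply: h_inj.
- by move=> x; rewrite !mem_filter => /andP[/hPQ-> _]; rewrite mem_index_enum.
- by move=> x; rewrite mem_filter => /andP[/leFH].
Qed.

(** * Prime divisor counts and weighted divisor sums *)

Definition omega n := size (primes n).

Lemma omega1 : omega 1 = 0.
Proof. by []. Qed.

Lemma omega_pfactor p i : prime p -> 0 < i -> omega (p ^ i) = 1.
Proof.
by move=> p_pr i_gt0; rewrite /omega primesX // primes_prime.
Qed.

Lemma omega_mul_leq m n : 0 < m -> 0 < n -> omega (m * n) <= omega m + omega n.
Proof.
move=> m_gt0 n_gt0; rewrite -size_cat; apply: uniq_leq_size.
  exact: primes_uniq.
by move=> p; rewrite mem_cat primesM.
Qed.

Lemma omega_mul m n : 0 < m -> 0 < n -> coprime m n -> omega (m * n) = omega m + omega n.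
Proof.
move=> m_gt0 n_gt0 co_mn; rewrite -size_cat; apply/perm_size/uniq_perm.
- exact: primes_uniq.
- by rewrite cat_uniq !primes_uniq andbT /= -coprime_has_primes.
by move=> p; rewrite mem_cat primesM.
Qed.

(** For [a = 0] this is the number of edges for the cyclic group of order [n]. The offset [a] counts
    the smaller primes already split off in the main induction. *)
Definition divsum a n := \sum_(d <- divisors n) (a + omega d).

Lemma divsum_gt0 b n : 0 < b -> 0 < n -> 0 < divsum b n.
Proof.
move=> b_gt0 n_gt0; rewrite /divsum (big_rem 1) ?divisor1 //=.
by rewrite omega1 addn0 ltn_addr.
Qed.

(** A divisor [d] is recovered from [gcdn d m] and [d %/ gcdn d m], so divisors of [m * n] inject
    into pairs of divisors. *)
Lemma sum_divisors_mul F m n : 0 < m -> 0 < n ->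
  \sum_(d <- divisors (m * n)) F d <=
    \sum_(u <- divisors m) \sum_(v <- divisors n) F (u * v).
Proof.
move=> m_gt0 n_gt0; pose h d := (gcdn d m, d %/ gcdn d m).
pose F2 (uv : nat * nat) := F (uv.1 * uv.2).
rewrite -[leqRHS](big_allpairs (F := F2)).
have hM d : (h d).1 * (h d).2 = d by rewrite /= mulnC divnK ?dvdn_gcdl.
apply: (leq_sum_inj (h := h)) => //; first exact: divisors_uniq.
- by apply: allpairs_uniq; rewrite ?divisors_uniq // => -[] ? ? [].
- by move=> d1 d2 _ _ eq_h; rewrite -[d1]hM eq_h hM.
- move=> d; rewrite -dvdn_divisors ?muln_gt0 ?m_gt0 // => dv_d.
  have d_gt0 : 0 < d by apply: dvdn_gt0 dv_d; rewrite muln_gt0 m_gt0.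
  have g_gt0 : 0 < gcdn d m by rewrite gcdn_gt0 d_gt0.
  apply/allpairsP; exists (h d); split => //=.
    by rewrite -dvdn_divisors // dvdn_gcdr.
  rewrite -dvdn_divisors //.
  rewrite -(@Gauss_dvdr _ (m %/ gcdn d m)).
    rewrite -(dvdn_pmul2r g_gt0) divnK ?dvdn_gcdl // mulnAC divnK //.
    exact: dvdn_gcdr.
  rewrite /coprime -(eqn_pmul2r g_gt0) muln_gcdl mul1n !divnK //.
    exact: dvdn_gcdr.
  exact: dvdn_gcdl.
- by move=> d _; rewrite /F2 hM.
Qed.

(** Termwise, [b + omega (u * v) <= (1 + omega u) * (b + omega v)] because [1 <= b]. *)
Lemma divsum_mul b m n : 0 < b -> 0 < m -> 0 < n ->
  divsum b (m * n) <= divsum 1 m * divsum b n.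
Proof.
move=> b_gt0 m_gt0 n_gt0; apply: leq_trans (sum_divisors_mul _ _ _) _ => //.
rewrite /divsum big_distrl /= big_seq [leqRHS]big_seq; apply: leq_sum => u du.
rewrite big_distrr /= big_seq [leqRHS]big_seq; apply: leq_sum => v dv.
have u_gt0 : 0 < u by move: du; rewrite -dvdn_divisors // => /dvdn_gt0->.
have v_gt0 : 0 < v by move: dv; rewrite -dvdn_divisors // => /dvdn_gt0->.
have := omega_mul_leq u_gt0 v_gt0; nia.
Qed.

(** Write a divisor as [p ^ i * v]: [i = 0] keeps the offset [a], and each of the [e] positive
    exponents adds at most one prime. *)
Lemma divsum_pfactor_mul a p e n : prime p -> 0 < n ->
  divsum a (p ^ e * n) <= divsum a n + e * divsum a.+1 n.
Proof.
move=> p_pr n_gt0; have p_gt1 := prime_gt1 p_pr.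
apply: leq_trans (sum_divisors_mul _ _ n_gt0) _; first by rewrite expn_gt0 ltnW.
pose S u := \sum_(v <- divisors n) (a + omega (u * v)).
apply: (@leq_trans (\sum_(0 <= i < e.+1) S (p ^ i))).
  apply: (leq_sum_inj (h := logn p)); rewrite ?divisors_uniq ?iota_uniq //.
  - move=> u v; rewrite -!dvdn_divisors ?expn_gt0 ?(ltnW p_gt1) //.
    move=> /(dvdn_pfactor _ _ p_pr)[i _ ->] /(dvdn_pfactor _ _ p_pr)[j _ ->].
    by rewrite !pfactorK // => ->.
  - move=> u; rewrite -dvdn_divisors ?expn_gt0 ?(ltnW p_gt1) //.
    move=> /(dvdn_pfactor _ _ p_pr)[i le_ie ->].
    by rewrite pfactorK // mem_index_iota.
  - move=> u; rewrite -dvdn_divisors ?expn_gt0 ?(ltnW p_gt1) //.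
    by move=> /(dvdn_pfactor _ _ p_pr)[i le_ie ->]; rewrite pfactorK.
rewrite big_nat_recl //; apply: leq_add.
  by rewrite /S /divsum expn0; apply: leq_sum => v _; rewrite mul1n.
rewrite -[e in e * _]subn0 -sum_nat_const_nat; apply: leq_sum => i _.
rewrite /S /divsum big_seq [leqRHS]big_seq; apply: leq_sum => v dv.
have v_gt0 : 0 < v by move: dv; rewrite -dvdn_divisors // => /dvdn_gt0->.
rewrite addSnnS leq_add2l; apply: leq_trans (omega_mul_leq _ v_gt0) _.
  by rewrite expn_gt0 ltnW.
by rewrite omega_pfactor.
Qed.

(** * Base-3 digit counts and the charge function *)

(** The number of base-3 digits, with value 1 at 0. Base 3 suits odd [p]: from [p ^ f <= s] it
    follows that [s] has more than [f] digits. *)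
Definition digits3 m := (trunc_log 3 m).+1.

Lemma digits3_le m v : m < 3 ^ v -> 0 < v -> digits3 m <= v.
Proof.
move=> lt_m v_gt0; rewrite /digits3 -(@ltn_exp2l 3) //.
have [->|m_gt0] := posnP m; first by rewrite trunc_log0 -(expn0 3) ltn_exp2l.
exact: leq_ltn_trans (trunc_logP _ m_gt0) lt_m.
Qed.

Lemma digits3_ge m v : 3 ^ v <= m -> v < digits3 m.
Proof. by move=> le_vm; rewrite ltnS trunc_log_max. Qed.

Lemma ltn_digits3 m : m < 3 ^ digits3 m.
Proof. exact: trunc_log_ltn. Qed.

Lemma digits3_mul m n : digits3 (m * n) <= digits3 m + digits3 n.
Proof.
apply: digits3_le => //; rewrite expnD.
by apply: ltn_mul; apply: ltn_digits3.
Qed.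

Lemma digits3_add m n : 0 < m -> 0 < n ->
  digits3 (m + n) <= digits3 m + digits3 n.
Proof.
move=> m_gt0 n_gt0; apply: digits3_le => //; rewrite expnD.
have := ltn_digits3 m; have := ltn_digits3 n.
have : 3 <= 3 ^ digits3 m by rewrite -{1}(expn1 3) leq_exp2l.
have : 3 <= 3 ^ digits3 n by rewrite -{1}(expn1 3) leq_exp2l.
nia.
Qed.

Lemma digits3_add5 n : 0 < n -> digits3 (5 + n) <= (digits3 n).+1.
Proof.
move=> n_gt0; apply: digits3_le => //; rewrite expnS.
have := ltn_digits3 n.
have : 3 <= 3 ^ digits3 n by rewrite -{1}(expn1 3) leq_exp2l.
lia.
Qed.

Lemma digits3_mulr m n : 0 < n -> digits3 (m * n) <= digits3 m + n.-1.
Proof.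
move=> n_gt0; apply: digits3_le; last by [].
have := ltn_digits3 m; rewrite expnD => lt_m.
suffices: n <= 3 ^ n.-1 by move: (3 ^ digits3 m) lt_m => x; nia.
case: n n_gt0 => // n _ /=; elim: n => // n IHn; rewrite expnS; lia.
Qed.

Lemma digits3_linear m : 10 <= m -> 3 * digits3 m + 1 <= m.
Proof.
move=> m_ge10; have [lt27|ge27] := ltnP m 27.
  have : digits3 m <= 3 by apply: digits3_le.
  lia.
have := @trunc_logP 3 m isT ltac:(lia).
have : 3 <= trunc_log 3 m by rewrite trunc_log_max.
rewrite /digits3; move: (trunc_log 3 m) => v v_ge3.
suffices: 3 * v + 4 <= 3 ^ v by lia.
by elim: v v_ge3 => // v IHv; rewrite leq_eqVlt => /predU1P[<-//|/IHv]; rewrite expnS; lia.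
Qed.

Lemma divsum_prime q : prime q -> divsum 1 q = 3.
Proof.
move=> q_pr; rewrite /divsum.
have dq : perm_eq (divisors q) [:: 1; q].
  apply: uniq_perm; rewrite ?divisors_uniq //=.
    by rewrite inE eq_sym neq_ltn prime_gt1 ?orbT.
  move=> d; rewrite -dvdn_divisors ?prime_gt0 // !inE.
  by apply/idP/pred2P => [/(primeP q_pr).2/pred2P | [->|->//]]; rewrite ?dvd1n.
by rewrite (perm_big _ dq) unlock /= omega1 /omega primes_prime.
Qed.

Lemma divsum25 : divsum 1 25 = 5. Proof. by rewrite /divsum unlock. Qed.
Lemma divsum35 : divsum 1 35 = 8. Proof. by rewrite /divsum unlock. Qed.

(** Induction removing the least prime [q] from [m = q * r]: this multiplies [divsum 1] by at most 3
    and costs at most [digits3 q] digits. At [m = 7] there is equality; at [m = 5] the bound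
    fails. *)
Lemma digits3_divsum m : 1 < m -> m != 5 ->
  (forall q, prime q -> q %| m -> 5 <= q) ->
  (3 * digits3 m + 1) * divsum 1 m <= 3 * m.
Proof.
have dig v x : 3 ^ v <= x < 3 ^ v.+1 -> digits3 x = v.+1.
  by rewrite /digits3 => /trunc_log_eq->.
elim/ltn_ind: m => m IHm m_gt1 m5 m_ge5.
set q := pdiv m; have q_pr : prime q by apply: pdiv_prime.
have q_ge5 : 5 <= q by apply: m_ge5; rewrite ?pdiv_dvd.
have [r def_m] : exists r, m = q * r.
  by exists (m %/ q); rewrite mulnC divnK // pdiv_dvd.
have [r_le1 | r_gt1] := leqP r 1.
  have def_q : m = q by move: r_le1 def_m m_gt1; case: (r) => [|[|//]]; lia.
  rewrite def_q divsum_prime // -def_q.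
  have [m_ge10 | m_lt10] := leqP 10 m; first by have := digits3_linear m_ge10; lia.
  have m_pr : prime m by rewrite def_q.
  have : [|| m == 6, m == 7, m == 8 | m == 9] by lia.
  by case/or4P => /eqP mE; move: m_pr; rewrite mE // (dig 1).
have r_ge5 p : prime p -> p %| r -> 5 <= p.
  by move=> p_pr dv_p; apply: m_ge5; rewrite // def_m dvdn_mull.
have r_ge : 5 <= r.
  apply: leq_trans (r_ge5 _ (pdiv_prime r_gt1) (pdiv_dvd r)) _.
  by apply: dvdn_leq (pdiv_dvd r); lia.
have le_qr : q <= r.
  apply: leq_trans (dvdn_leq _ (pdiv_dvd r)); last by lia.
  apply: pdiv_min_dvd; first exact/prime_gt1/pdiv_prime.
  by rewrite def_m dvdn_mull // pdiv_dvd.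
have w_m : divsum 1 m <= 3 * divsum 1 r.
  by rewrite def_m -(divsum_prime q_pr) divsum_mul //; lia.
have dig_m : digits3 m <= digits3 q + digits3 r by rewrite def_m digits3_mul.
(* The induction hypothesis does not cover [r = 5], but then [5 <= q <= r] leaves only [m = 25]. *)
have [r5 | r_neq5] := eqVneq r 5.
  have -> : m = 25 by lia.
  by rewrite divsum25 (dig 2).
have IHr := IHm r ltac:(nia) r_gt1 r_neq5 r_ge5.
have dig_r : 1 < digits3 r by apply: digits3_ge; lia.
(* The sufficient inequality below fails exactly for [q = 5] and [r = 7]. *)
have [m35 | m_neq35] := eqVneq m 35; first by rewrite m35 divsum35 (dig 3).
suffices: 9 * digits3 q <= (q - 3) * (3 * digits3 r + 1).
  move: (digits3 m) (digits3 q) (digits3 r) (divsum 1 m) (divsum 1 r) w_m dig_m IHr {dig_r}.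
  move=> dm dq dr wm wr le_w le_d IHr le_q.
  have : (3 * dm + 1) * wm <= (3 * (dq + dr) + 1) * (3 * wr) by apply: leq_mul; lia.
  have : 3 * (3 * (dq + dr) + 1) <= q * (3 * dr + 1) by nia.
  nia.
have dig_r7 : 7 <= 3 * digits3 r + 1 by lia.
have [q_ge10 | q_lt10] := leqP 10 q.
  have := digits3_linear q_ge10 => dig_q.
  by apply: leq_trans (leq_mul (leqnn (q - 3)) dig_r7); lia.
have q_neq n : ~~ prime n -> q != n by apply: contraNneq => <-.
have r_neq n : 2 %| n -> r != n.
  by apply: contraTneq => <-; apply/negP => /(r_ge5 2 isT).
have q_neq9 := q_neq 9 isT; have q_neq6 := q_neq 6 isT.
have r_neq6 := r_neq 6 isT; have r_neq8 := r_neq 8 isT.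
have dig_q : digits3 q = 2 by apply: (dig 1); lia.
have [r_ge9 | r_lt9] := leqP 9 r.
  have dig_r3 := @digits3_ge r 2 r_ge9.
  apply: (@leq_trans (2 * 10)); first by rewrite dig_q.
  by apply: leq_mul; lia.
have [q_ge7 | q_lt7] := leqP 7 q.
  apply: (@leq_trans (4 * 7)); first by rewrite dig_q.
  by apply: leq_mul; lia.
by case/eqP: m_neq35; rewrite def_m; suffices [-> ->] : q = 5 /\ r = 7 by []; lia.
Qed.

(* A class of [m] conjugate cyclic subgroups is worth at least [charge m / 3]
   copies of the divisor sum of [N]; subadditivity of [charge] lets classes be
   merged.  The value at 5 is lower because
   [3 * 5 < (3 * digits3 5 + 1) * divsum 1 5]. *)
Definition charge m :=
  if m == 0 then 0 else if m == 1 then 3 else if m == 5 then 5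
  else 3 * digits3 m + 1.

Lemma digits3_1 : digits3 1 = 1. Proof. by rewrite /digits3 trunc_log1. Qed.
Lemma digits3_5 : digits3 5 = 2.
Proof. by rewrite /digits3 (@trunc_log_eq 3 1). Qed.
Lemma digits3_2 : digits3 2 = 1.
Proof. by rewrite /digits3 (@trunc_log_eq 3 0). Qed.
Lemma digits3_10 : digits3 10 = 3.
Proof. by rewrite /digits3 (@trunc_log_eq 3 2). Qed.

Lemma charge_le m : charge m <= 3 * digits3 m + 1.
Proof.
rewrite /charge; have [//|_] := eqVneq m 0.
have [->|_] := eqVneq m 1; first by rewrite digits3_1.
by have [->|] := eqVneq m 5; first rewrite digits3_5.
Qed.

Lemma charge_ge3 m : 0 < m -> 3 <= charge m.
Proof.
by case: m => [|[|m]] // _; rewrite /charge /=; case: ifP; rewrite // /digits3; lia.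
Qed.

Lemma charge_gt3 m : 1 < m -> 3 < charge m.
Proof.
by case: m => [|[|m]] // _; rewrite /charge /=; case: ifP; rewrite // /digits3; lia.
Qed.

(** Follows from subadditivity of [digits3], a summand 1 or 5 adding at most one digit. The case
    [5 + 5] is tight: [charge 10 = 10]. *)
Lemma chargeD m n : charge (m + n) <= charge m + charge n.
Proof.
wlog le_mn : m n / m <= n => [h|].
  by case: (leqP m n) => [/h//|/ltnW/h]; rewrite addnC [charge m + _]addnC.
have := charge_le (m + n); have [->|m_gt0] := posnP m; first by [].
have n_gt0 : 0 < n by lia.
have := digits3_add m_gt0 n_gt0; have := digits3_add5 n_gt0.
have := digits3_add5 m_gt0; rewrite [5 + m]addnC.
have := digits3_1; have := digits3_2; have := digits3_10.
rewrite {3 4}/charge.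
have [->|m1] := eqVneq m 1.
  have [->|n1] := eqVneq n 1; first by rewrite -[1 + 1]/2. 
  have [->|n5] := eqVneq n 5; first by rewrite /=; lia.
  have -> : n == 0 = false by lia.
  rewrite /=; lia.
have -> : m == 0 = false by lia.
have -> : n == 0 = false by lia.
have -> : n == 1 = false by lia.
have [->|m5] := eqVneq m 5; have [->|n5] := eqVneq n 5; rewrite /=; try lia.
by rewrite -[5 + 5]/10; lia.
Qed.

(** For a class of [m * k] conjugates, [m] will collect the prime factors above [p] and [k] the
    others. The factor [k] multiplies the right-hand side but adds at most [k - 1] digits. *)
Lemma charge_divsum k m : 0 < k -> 0 < m ->
  (forall q, prime q -> q %| m -> 5 <= q) ->
  charge (m * k) * divsum 1 m <= 3 * (m * k).
Proof.
move=> k_gt0 m_gt0 m_ge5; have [->|m1] := eqVneq m 1.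
  have -> : divsum 1 1 = 1 by rewrite /divsum unlock.
  rewrite mul1n muln1; have [->//|k1] := eqVneq k 1.
  have : digits3 k <= k.-1.
    apply: digits3_le; last by lia.
    case: k k_gt0 k1 => [|[|k]] // _ _ /=; elim: k => // k IHk.
    by rewrite expnS; lia.
  by have := charge_le k; lia.
have [->|m5] := eqVneq m 5.
  rewrite divsum_prime //; have [->|k1] := eqVneq k 1; first by [].
  have := charge_le (5 * k); have := @digits3_linear (5 * k) ltac:(lia); lia.
have m_gt1 : 1 < m by lia.
have := digits3_divsum m_gt1 m5 m_ge5.
have := charge_le (m * k); have := @digits3_mulr m k k_gt0.
move: (divsum _ _) (digits3 (m * k)) (digits3 m) (charge _) (isT : 0 < digits3 m).
move=> w dk d c d_gt0 le_dk le_c le_w.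
have : c <= k * (3 * d + 1) by nia.
nia.
Qed.

(** * Arithmetic of the numbers of cyclic subgroups of order a power of p *)

Lemma sum_totient_pfactor p i : prime p ->
  \sum_(j < i.+1) totient (p ^ j) = p ^ i.
Proof.
move=> p_pr; elim: i => [|i IHi]; first by rewrite big_ord1.
rewrite big_ord_recr /= IHi totient_pfactor //= expnS.
by rewrite -[X in X + _]mul1n -mulnDl add1n prednK ?prime_gt0.
Qed.

(** Here [s i] stands for the number of cyclic subgroups of order [p ^ i], and [M i] for the number
    of solutions of x^(p^i) = 1. The terms between [l] and [e] vanish, so [M e = M l]. *)
Lemma level_sum_dvd (p e l : nat) (s : nat -> nat)
    (M := fun i => \sum_(j < i.+1) s j * totient (p ^ j)) :
  prime p -> s 0 = 1 -> l < e -> (forall i, i <= e -> p ^ i %| M i) ->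
  (forall i, i <= e -> (0 < s i) = (i <= l)) ->
  p ^ e %| M l.
Proof.
move=> p_pr s0 lt_le dv_s s_gt0.
suffices <- : M e = M l by apply: dv_s.
rewrite /M -!(big_mkord xpredT (fun j => s j * totient (p ^ j))).
rewrite (big_cat_nat (n := l.+1)) //=; last by rewrite ltnS ltnW.
rewrite [X in _ + X]big_nat_cond [X in _ + X]big1 ?addn0 // => i.
rewrite andbT ltnS => /andP[lt_li le_ie].
by have := s_gt0 i le_ie; rewrite [i <= l]leqNgt lt_li; case: (s i).
Qed.

(** If every [s i] with [0 < i <= l] were below p^(e-l), then [M l] would be at most 1 + (p^(e-l) -
    1)(p^l - 1) < p^e, against [p ^ e %| M l]. *)
Lemma level_large (p e l : nat) (s : nat -> nat)
    (M := fun i => \sum_(j < i.+1) s j * totient (p ^ j)) :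
  prime p -> s 0 = 1 -> l < e -> (forall i, i <= e -> p ^ i %| M i) ->
  (forall i, i <= e -> (0 < s i) = (i <= l)) ->
  exists i, [/\ 0 < i, i <= l & p ^ (e - l) <= s i].
Proof.
move=> p_pr s0 lt_le dv_s s_gt0.
have M_l := level_sum_dvd p_pr s0 lt_le dv_s s_gt0; rewrite -/(M l) in M_l.
have p_gt1 := prime_gt1 p_pr.
have [/existsP[i /andP[i_gt0 le_i]] | /existsPn small] :=
    boolP [exists i : 'I_l.+1, (0 < i) && (p ^ (e - l) <= s i)].
  by exists i; split; rewrite // -ltnS.
have M_gt0 : 0 < M l by rewrite /M big_ord_recl s0.
have := dvdn_leq M_gt0 M_l; rewrite leqNgt => /negP[].
set f := e - l in small *; have def_e : e = f + l by rewrite subnK // ltnW.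
have pf_gt0 : 0 < p ^ f by rewrite expn_gt0 ltnW.
have : M l <= 1 + (p ^ f).-1 * \sum_(i < l) totient (p ^ i.+1).
  rewrite /M big_ord_recl s0 leq_add2l big_distrr /=; apply: leq_sum => i _.
  rewrite leq_mul2r; apply/orP; right.
  by have := small (lift ord0 i); rewrite -ltnNge /=; move: (s _); lia.
have := sum_totient_pfactor l p_pr; rewrite big_ord_recl /= expn0 def_e expnD.
have : 1 < p ^ f by rewrite -(expn0 p) ltn_exp2l // subn_gt0.
move: (M l) (p ^ f) (\sum_(i < l) _) (p ^ l) => m x y z x_gt1 [<-] le_m.
by change (totient 1) with 1; nia.
Qed.

(** This serves the gap [e - l = 1], where [s i >= p] is too weak. Not all [s i] are 1, since
    otherwise [M l = p ^ l]. At the least [i] with [s i <> 1], [M i] is p^(i-1) (1 + s_i (p - 1)),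
    and divisibility by [p ^ i] gives the congruence. *)
Lemma level_cong (p e l : nat) (s : nat -> nat)
    (M := fun i => \sum_(j < i.+1) s j * totient (p ^ j)) :
  prime p -> s 0 = 1 -> l < e -> (forall i, i <= e -> p ^ i %| M i) ->
  (forall i, i <= e -> (0 < s i) = (i <= l)) ->
  exists i, [/\ 0 < i, i <= l, p < s i & s i = 1 %[mod p]].
Proof.
move=> p_pr s0 lt_le dv_s s_gt0.
have M_l := level_sum_dvd p_pr s0 lt_le dv_s s_gt0; rewrite -/(M l) in M_l.
have p_gt1 := prime_gt1 p_pr.
have ex_i : exists i, (i <= l) && (s i != 1).
  have [/existsP[i si] | /existsPn all1] := boolP [exists i : 'I_l.+1, s i != 1].
    by exists i; rewrite si -ltnS ltn_ord.
  have : M l = p ^ l.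
    rewrite -(sum_totient_pfactor l p_pr); apply: eq_bigr => i _.
    by have /negPn/eqP-> := all1 i; rewrite mul1n.
  move=> Ml; have := M_l; rewrite Ml => /dvdn_leq.
  by rewrite expn_gt0 ltnW // leq_exp2l // leqNgt lt_le => /(_ isT).
case: (ex_minnP ex_i) => i /andP[le_il si] min_i.
have i_gt0 : 0 < i by rewrite lt0n; apply: contraNneq si => ->; rewrite s0.
have le_ie : i <= e by apply: leq_trans le_il (ltnW lt_le).
have si_gt0 : 0 < s i by rewrite s_gt0.
have : p ^ i %| p ^ i.-1 * (1 + s i * p.-1).
  have := dv_s i le_ie; rewrite /M big_ord_recr /= totient_pfactor //.
  rewrite (_ : \sum_(j < i) _ = p ^ i.-1); first by rewrite mulnDr muln1; congr (_ %| _ + _); lia.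
  rewrite -(sum_totient_pfactor i.-1 p_pr) prednK //; apply: eq_bigr => j _.
  suffices -> : s j = 1 by rewrite mul1n.
  apply/eqP/negPn/negP => sj; have := min_i j; rewrite sj andbT.
  by move=> /(_ (leq_trans (ltnW (ltn_ord j)) le_il)); rewrite leqNgt ltn_ord.
rewrite -{1}(prednK i_gt0) expnSr dvdn_pmul2l ?expn_gt0 ?(ltnW p_gt1) // => dv_si.
have cong_si : s i = 1 %[mod p].
  apply/eqP; rewrite eqn_mod_dvd // -(dvdn_addl _ dv_si).
  by rewrite (_ : _ + _ = s i * p) ?dvdn_mull //; nia.
exists i; split=> //; rewrite ltnNge; apply/negP => le_sp.
case/eqP: si; move: cong_si; rewrite [1 %% p]modn_small //.
move: le_sp; rewrite leq_eqVlt => /predU1P[->|lt_sp]; first by rewrite modnn.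
by rewrite modn_small.
Qed.

(** * Cyclic p-subgroups sorted by order, and Frobenius' theorem *)

Import GroupScope.
Local Open Scope nat_scope.

Definition primes_ge k : nat_pred := [pred q | k <= q].

Definition level (gT : finGroupType) (G : {group gT}) p i :=
  [set Y in cyclic_subgroups G | #|Y| == (p ^ i)%N].

Lemma cyclic_subgroupsP (gT : finGroupType) (G H : {group gT}) :
  reflect (H \subset G /\ cyclic H) (H \in cyclic_subgroups G).
Proof. by rewrite !inE; apply: andP. Qed.

Lemma levelP (gT : finGroupType) (G : {group gT}) p i (Y : {group gT}) :
  reflect [/\ Y \subset G, cyclic Y & #|Y| = (p ^ i)%N] (Y \in level G p i).
Proof. by rewrite 2!inE inE -andbA; apply: (iffP and3P) => -[? ? /eqP]. Qed.

Lemma level_logn (gT : finGroupType) (G Y : {group gT}) p i : prime p ->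
  Y \in level G p i -> i <= logn p #|G|.
Proof.
move=> p_pr /levelP[sYG _ oY]; rewrite -pfactor_dvdn ?cardG_gt0 // -oY.
exact: cardSg.
Qed.

Lemma card_level0 (gT : finGroupType) (G : {group gT}) p : #|level G p 0| = 1%N.
Proof.
apply/eqP/cards1P; exists 1%G; apply/setP=> Y; rewrite !inE.
apply/andP/eqP => [[_ /eqP oY] | ->]; first by apply/group_inj/card1_trivg.
by rewrite sub1G cyclic1 cards1.
Qed.

Lemma level_down (gT : finGroupType) (G : {group gT}) p i j :
  i <= j -> 0 < #|level G p j| -> 0 < #|level G p i|.
Proof.
move=> le_ij /card_gt0P[Y /levelP[sYG /cyclicP[x defY] oY]].
apply/card_gt0P; exists <[x ^+ (p ^ (j - i))]>%G; apply/levelP; split.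
- by rewrite /= cycle_subG groupX // -cycle_subG -defY.
- exact: cycle_cyclic.
- by rewrite -orderE (orderXexp _ (n := j)) ?subKn // orderE -defY.
Qed.

(** Sort the solutions by the cyclic subgroup they generate; one of order [p ^ j] has
    [totient (p ^ j)] generators. *)
Lemma card_Ldiv_level (gT : finGroupType) (G : {group gT}) p i : prime p ->
  #|'Ldiv_(p ^ i)(G)| = (\sum_(j < i.+1) #|level G p j| * totient (p ^ j))%N.
Proof.
move=> p_pr; pose S := [set Y in cyclic_subgroups G | #|Y| %| p ^ i].
rewrite -sum1_card (partition_big (fun x => <[x]>%G) [in S]) /=; last first.
  move=> x; rewrite !inE -order_dvdn cycle_subG cycle_cyclic andbT orderE.
  by case/andP=> -> ->.
transitivity (\sum_(Y in S) totient #|Y|).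
  apply: eq_bigr => Y; rewrite 2!inE inE -andbA => /and3P[sYG cycY dvY].
  case/cyclicP: cycY => y defY; rewrite defY -orderE totient_gen sum1dep_card.
  apply: eq_card => x; rewrite !inE /generator -defY.
  apply/andP/eqP => [[_ /eqP <-] // | eq_Yx].
  have sxG : <[x]> \subset G by rewrite -eq_Yx.
  rewrite -cycle_subG sxG -order_dvdn orderE -eq_Yx dvY; split=> //.
  by apply/eqP/group_inj.
rewrite (partition_big (fun Y : {group gT} => inord (logn p #|Y|) : 'I_i.+1)
  predT) //=; apply: eq_bigr => j _.
rewrite -sum_nat_const; apply: congr_big => // Y.
  apply/andP/levelP => [[] | [sYG cycY oY]].
    rewrite 2!inE inE -andbA => /and3P[sYG cycY].
    move=> /(dvdn_pfactor _ _ p_pr)[k le_ki oY].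
    by rewrite oY pfactorK // => /eqP <-; rewrite inordK.
  rewrite 2!inE inE sYG cycY oY pfactorK // inord_val eqxx.
  by rewrite dvdn_exp2l // -ltnS.
move=> /andP[]; rewrite 2!inE inE -andbA => /and3P[sYG cycY].
move=> /(dvdn_pfactor _ _ p_pr)[k le_ki oY].
by rewrite oY pfactorK // => /eqP <-; rewrite inordK.
Qed.

(** Take for [l] the largest exponent with [p ^ l] an element order. The last two conclusions serve
    the gaps [e - l >= 2] and [e - l = 1] respectively. *)
Lemma level_gap (gT : finGroupType) (G : {group gT}) p (e := logn p #|G|) :
  prime p -> #|level G p e| = 0%N ->
  exists l, [/\ l < e, forall i, i <= l -> 0 < #|level G p i|,
    exists i, [/\ 0 < i, i <= l & p ^ (e - l) <= #|level G p i|]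
  & exists i, [/\ 0 < i, i <= l, p < #|level G p i|
                & #|level G p i| = 1 %[mod p]]].
Proof.
move=> p_pr lev_e.
have ex_l : exists i, 0 < #|level G p i| by exists 0%N; rewrite card_level0.
have ub_l i : 0 < #|level G p i| -> i <= e.
  by case/card_gt0P=> Y /(level_logn p_pr).
case: (ex_maxnP ex_l ub_l) => l lev_l max_l.
have lt_le : l < e.
  rewrite ltn_neqAle ub_l // andbT; apply/eqP=> l_e.
  by move: lev_l; rewrite l_e lev_e.
have lev_gt0 i : i <= e -> (0 < #|level G p i|) = (i <= l).
  by move=> _; apply/idP/idP => [/max_l //|le_il]; apply: level_down lev_l.
have dv_lev i : i <= e -> p ^ i %| \sum_(j < i.+1) #|level G p j| * totient (p ^ j).
  move=> le_ie; rewrite -card_Ldiv_level //; apply: Frobenius_Ldiv.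
  by rewrite pfactor_dvdn.
exists l; split=> //.
- by move=> i le_il; rewrite lev_gt0 // (leq_trans le_il (ltnW lt_le)).
- exact: (level_large (s := fun i => #|level G p i|) p_pr (card_level0 G p) lt_le).
- exact: (level_cong (s := fun i => #|level G p i|) p_pr (card_level0 G p) lt_le).
Qed.

(** * Conjugates, centralizers and the weight of a level *)

Lemma partn_orbit_level (gT : finGroupType) (G Y : {group gT}) p i
    (pi := primes_ge p.+1) : prime p -> Y \in level G p i ->
  (#|G|`_pi = #|orbit 'JG G Y|`_pi * #|'C_G(Y)|`_pi)%N.
Proof.
move=> p_pr /levelP[sYG cycY oY].
have p_gt1 := prime_gt1 p_pr.
have sCN : 'C_G(Y) \subset 'N_G(Y) by rewrite setIS ?cent_sub.
(* The quotient of the normalizer by the centralizer embeds in [Aut Y], whose order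
   [totient (p ^ i)] has no prime factor above [p]. *)
have NC1 : #|'N_G(Y) : 'C_G(Y)|`_pi = 1%N.
  have : #|'N_G(Y) : 'C_G(Y)| %| totient (p ^ i).
    rewrite -oY -card_Aut_cyclic //.
    apply: dvdn_trans (cardSg (Aut_conj_aut Y 'N_G(Y))).
    rewrite card_morphim ker_conj_aut (setIidPr (subsetIr G 'N(Y))).
    by rewrite -[X in _ %| X]indexgI /= -setIA (setIidPr (cent_sub Y)).
  move=> dv_NC; apply: part_p'nat; apply/pnatP => // q q_pr dv_q.
  rewrite !inE -ltnNge ltnS; have {dv_q} := dvdn_trans dv_q dv_NC.
  case: i {oY dv_NC} => [|i]; first by rewrite dvdn1 => /eqP->; apply: ltnW.
  rewrite totient_pfactor //= Euclid_dvdM // => /orP[] dv_q.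
    by rewrite (leq_trans (dvdn_leq _ dv_q)) ?leq_pred //; lia.
  by move: dv_q; rewrite Euclid_dvdX // => /andP[/dvdn_leq-> //]; apply: ltnW.
rewrite card_orbit astab1JG mulnC -(Lagrange (subsetIl G 'N(Y))).
rewrite -(Lagrange sCN) !partnM ?muln_gt0 ?cardG_gt0 ?indexg_gt0 //.
by rewrite NC1 muln1.
Qed.

Lemma orbit_charge (gT : finGroupType) (G Y : {group gT}) p i b
    (pi := primes_ge p.+1) (O := orbit 'JG G Y) :
  prime p -> odd #|G| -> 0 < i -> 0 < b -> Y \in level G p i ->
  charge #|O| * divsum b #|G|`_pi <= 3 * \sum_(Z in O) divsum b #|'C_G(Z)|`_pi.
Proof.
move=> p_pr oddG i_gt0 b_gt0 levY.
have p_odd : odd p.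
  case/levelP: levY => sYG _ oY; apply: dvdn_odd oddG.
  by apply: dvdn_trans (cardSg sYG); rewrite oY dvdn_exp.
have -> : \sum_(Z in O) divsum b #|'C_G(Z)|`_pi = (#|O| * divsum b #|'C_G(Y)|`_pi)%N.
  rewrite -sum_nat_const; apply: eq_bigr => _ /imsetP[x Gx ->] /=.
  by rewrite centJ -{1}(conjGid Gx) -conjIg cardJg.
rewrite (partn_orbit_level p_pr levY) -/O.
have O_gt0 : 0 < #|O| by rewrite card_orbit.
have odd_O : odd #|O| by apply: dvdn_odd oddG; apply: dvdn_orbit.
(* Since [p] is odd, it is at least 3, and an odd prime above it is at least 5. *)
have ge5 q : prime q -> q %| #|O|`_pi -> 5 <= q.
  move=> q_pr dv_q; have : q \in pi.
    exact: (pnatP _ (part_gt0 pi _) (part_pnat pi #|O|)).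
  have : odd q by apply: dvdn_odd odd_O; apply: dvdn_trans dv_q (dvdn_part _ _).
  rewrite !inE; move: (prime_gt1 p_pr) p_odd; lia.
have := charge_divsum (part_gt0 pi^' #|O|) (part_gt0 pi #|O|) ge5.
rewrite partnC // => le_O.
have := divsum_mul b_gt0 (part_gt0 pi #|O|) (part_gt0 pi #|'C_G(Y)|).
move: le_O; move: (charge _) (divsum 1 _) (divsum b _) (divsum b _) => c w1 w2 w3.
nia.
Qed.

Lemma level_charge (gT : finGroupType) (G : {group gT}) p i b
    (pi := primes_ge p.+1) :
  prime p -> odd #|G| -> 0 < i -> 0 < b ->
  charge #|level G p i| * divsum b #|G|`_pi
    <= 3 * \sum_(Y in level G p i) divsum b #|'C_G(Y)|`_pi.
Proof.
move=> p_pr oddG i_gt0 b_gt0.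
have part_lev : partition (orbit 'JG G @: level G p i) (level G p i).
  apply: orbit_partition; apply/actsP => x Gx Y /=.
  apply/levelP/levelP => -[sYG cycY oY]; split.
  - by rewrite -(conjSg _ _ x) (conjGid Gx).
  - by rewrite -(cyclicJ _ x).
  - by rewrite -oY /= cardJg.
  - by rewrite /= -(conjGid Gx) conjSg.
  - by rewrite cyclicJ.
  - by rewrite /= cardJg.
rewrite (set_partition_big _ part_lev) /= (card_partition part_lev) /=.
apply: (@leq_trans (\sum_(O in orbit 'JG G @: level G p i)
                      charge #|O| * divsum b #|G|`_pi)); last first.
  rewrite big_distrr; apply: leq_sum => _ /imsetP[Y levY ->]; exact: orbit_charge levY.
rewrite -big_distrl leq_mul2r; apply/orP; right.
apply: (big_ind2 (fun m n => charge m <= n)) => // m1 n1 m2 n2 le1 le2.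
by apply: leq_trans (chargeD _ _) (leq_add _ _).
Qed.

(** In a nilpotent group the Hall p'-subgroup centralizes the Sylow p-subgroup, which contains
    [Y]. *)
Lemma nilpotent_level_cent (gT : finGroupType) (G Y : {group gT}) p i
    (pi := primes_ge p.+1) :
  nilpotent G -> prime p -> Y \in level G p i -> #|'C_G(Y)|`_pi = #|G|`_pi.
Proof.
move=> nilG p_pr /levelP[sYG _ oY].
apply/eqP; rewrite eqn_dvd partn_dvd ?cardSg ?subsetIl ?cardG_gt0 //=.
have sub_pi : {subset pi <= p^'}.
  by move=> q; rewrite !inE => lt_pq; rewrite neq_ltn lt_pq orbT.
rewrite -(partn_part _ sub_pi) partn_dvd ?cardG_gt0 //.
rewrite -(card_Hall (nilpotent_pcore_Hall p^' nilG)); apply: cardSg.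
have /dprodP[_ _ cOO _] := nilpotent_pcoreC p nilG.
rewrite subsetI pcore_sub (subset_trans cOO) // centS //.
rewrite (sub_Hall_pcore (nilpotent_pcore_Hall p nilG)) //.
by rewrite /pgroup oY pnatX pnat_id.
Qed.

(** The last two clauses let level [i] pay, strictly, for itself and for one or [f] missing levels.
    In the last one [f = 1] must be excluded: for nilpotent [G] and [p = s = 2], [L = 2 * w]. *)
Lemma level_weight (gT : finGroupType) (G : {group gT}) p i b
    (pi := primes_ge p.+1) (s := #|level G p i|) (w := divsum b #|G|`_pi)
    (L := \sum_(Y in level G p i) divsum b #|'C_G(Y)|`_pi) :
  nilpotent G \/ odd #|G| -> prime p -> 0 < i -> 0 < b -> 0 < s ->
  [/\ w <= L,
      L <= w -> exists2 Y, Y \in level G p i & #|'C_G(Y)|`_pi = #|G|`_pi,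
      p < s -> s = 1 %[mod p] -> 2 * w < L
    & forall f, 1 < f -> p ^ f <= s -> f.+1 * w < L].
Proof.
move=> hG p_pr i_gt0 b_gt0 s_gt0; have p_gt1 := prime_gt1 p_pr.
have w_gt0 : 0 < w by apply: divsum_gt0; rewrite ?part_gt0.
have [Y levY] := card_gt0P s_gt0.
case: hG => [nilG | oddG].
  have defL : L = s * w.
    rewrite -sum_nat_const; apply: eq_bigr => Z levZ.
    by rewrite (nilpotent_level_cent nilG p_pr levZ).
  split=> [|_| lt_ps _ | f f_gt1 le_s]; first by rewrite defL leq_pmull.
  - by exists Y; rewrite // (nilpotent_level_cent nilG p_pr levY).
  - by rewrite defL ltn_pmul2r //; lia.
  - rewrite defL ltn_pmul2r // (leq_trans _ le_s) //.
    apply: (@leq_trans (2 ^ f)); last by rewrite leq_exp2r // ltnW.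
    by case: f f_gt1 {le_s} => [|[|f]] // _; elim: f => // f IHf; rewrite expnS; lia.
have p_odd : odd p.
  case/levelP: levY => sYG _ oY; apply: dvdn_odd oddG.
  by apply: dvdn_trans (cardSg sYG); rewrite oY dvdn_exp.
have p_ge3 : 2 < p by move: p_gt1 p_odd; case: (p) => [|[|[]]].
have le_L : charge s * w <= 3 * L by apply: level_charge.
(* Here [charge s >= 3 * v.+1 + 1], and the final 1 makes the inequality strict. *)
have L_big v : 3 ^ v <= s -> s != 5 -> 1 < s -> v.+1 * w < L.
  move=> le_s s5 s_gt1; have := digits3_ge le_s.
  have : charge s = 3 * digits3 s + 1.
    by rewrite /charge !ifN //; lia.
  by move=> ch lt_v; move: le_L; rewrite ch; nia.
split=> [|le_Lw | lt_ps s_cong | f f_gt1 le_s].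
- by have := charge_ge3 s_gt0; nia.
- exists Y; rewrite // (partn_orbit_level p_pr levY) -/pi.
  (* A second member would raise the charge above 3 and [L] above [w]; so [Y] is alone at its level,
     hence fixed by conjugation. *)
  have s1 : s <= 1 by rewrite leqNgt; apply/negP => /charge_gt3; nia.
  rewrite (_ : #|orbit 'JG G Y| = 1); first by rewrite partn1 mul1n.
  apply/eqP; rewrite eqn_leq (leq_trans _ s1) ?subset_leq_card //=.
    by rewrite card_orbit.
  apply/subsetP => _ /imsetP[x Gx ->] /=.
  case/levelP: levY => sYG cycY oY; apply/levelP; split.
  - by rewrite /= -(conjGid Gx) conjSg.
  - by rewrite cyclicJ.
  - by rewrite /= cardJg.
- apply: (L_big 1); [exact: leq_trans (ltnW lt_ps) | | exact: ltn_trans lt_ps].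
  (* If [s] were 5, the odd prime [p] would divide 4. *)
  apply: contra_eqN s_cong => /eqP->; rewrite eqn_mod_dvd // subn1 /=.
  by rewrite -[4]/(2 ^ 2) Euclid_dvdX // andbT gtnNdvd.
- have ge_s : 3 ^ f <= s by apply: leq_trans le_s; rewrite leq_exp2r // ltnW.
  have : 9 <= 3 ^ f by rewrite -[9]/(3 ^ 2) leq_exp2l.
  by move=> ge9; apply: L_big => //; lia.
Qed.

(** If level [e] is inhabited, each of the levels 1 to [e] weighs at least [w]. Otherwise one level
    weighs more than [(e - l).+1 * w] and the other [l - 1] inhabited ones at least [w] each, so the
    total is strictly larger and equality cannot occur. *)
Lemma levels_weight (gT : finGroupType) (G : {group gT}) p b
    (pi := primes_ge p.+1) (e := logn p #|G|) (w := divsum b #|G|`_pi)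
    (L := fun i => \sum_(Y in level G p i) divsum b #|'C_G(Y)|`_pi) :
  nilpotent G \/ odd #|G| -> prime p -> 0 < b ->
  e * w <= \sum_(i < e) L i.+1 /\
  (\sum_(i < e) L i.+1 <= e * w -> 0 < e ->
    exists2 Y, Y \in level G p e & #|'C_G(Y)|`_pi = #|G|`_pi).
Proof.
move=> hG p_pr b_gt0.
have w_gt0 : 0 < w by apply: divsum_gt0; rewrite ?part_gt0.
have wL i : 0 < #|level G p i.+1| -> w <= L i.+1.
  by case/(level_weight hG p_pr (ltn0Sn i) b_gt0).
have [lev_e | lev_e] := posnP #|level G p e|; last first.
  have ge_w i : i < e -> w <= L i.+1.
    by move=> lt_ie; apply: wL; apply: level_down lev_e.
  split.
    rewrite -[e in e * w]card_ord -sum_nat_const; apply: leq_sum => i _.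
    exact: ge_w.
  case: (e) lev_e ge_w => // d lev_d ge_w; rewrite big_ord_recr /= => le_w _.
  have [_ + _ _] := level_weight hG p_pr (ltn0Sn d) b_gt0 lev_d; apply.
  rewrite -/pi -/w -/(L _).
  (* The lower levels already take [d * w], so equality leaves at most [w] for the top level. *)
  suffices: d * w <= \sum_(i < d) L i.+1.
    by move: (L d.+1) (\sum_(i < d) L i.+1) le_w => x y; rewrite mulSn; lia.
  rewrite -[d in d * w]card_ord -sum_nat_const; apply: leq_sum => i _.
  by apply: ge_w; apply: ltnW; rewrite ltnS.
have [l [lt_le lev_gt0 large cong]] := level_gap p_pr lev_e.
suffices lt_w : e * w < \sum_(i < e) L i.+1.
  by split; [exact: ltnW | rewrite leqNgt lt_w].
have [i [i_gt0 le_il lt_L]] : exists i, [/\ 0 < i, i <= l & (e - l).+1 * w < L i].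
  have [f1 | f1] := eqVneq (e - l) 1.
    have [i [i_gt0 le_il lt_pi cong_i]] := cong; exists i; split=> //.
    have [_ _ + _] := level_weight hG p_pr i_gt0 b_gt0 (lev_gt0 i le_il).
    by rewrite f1; apply.
  have [i [i_gt0 le_il le_pi]] := large; exists i; split=> //.
  have [_ _ _] := level_weight hG p_pr i_gt0 b_gt0 (lev_gt0 i le_il).
  by apply; rewrite // ltn_neqAle eq_sym f1 subn_gt0.
have lt_ie : i.-1 < e by lia.
have lt_i'l : i.-1 < l by lia.
apply: (@leq_trans (\sum_(j < l) L j.+1)); last first.
  rewrite -!(big_mkord xpredT (fun j => L j.+1)).
  by rewrite [leqRHS](big_cat_nat (n := l)) ?leq_addr //; apply: ltnW.
rewrite (bigD1 (Ordinal lt_i'l)) //= prednK //.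
have : l.-1 * w <= \sum_(j < l | j != Ordinal lt_i'l) L j.+1.
  rewrite -[l.-1](_ : #|[pred j : 'I_l | j != Ordinal lt_i'l]| = _).
    by rewrite -sum_nat_const; apply: leq_sum => j _; apply/wL/lev_gt0.
  by rewrite cardC1 card_ord.
move: (L i) (bigop.body _ _ _) lt_L => x y lt_L le_rest.
suffices: e * w <= (e - l).+1 * w + l.-1 * w by lia.
by rewrite -mulnDl leq_mul2r; apply/orP; right; lia.
Qed.

(** * Splitting off the smallest prime *)

(** The group counterpart of [divsum a], with cyclic subgroups in place of divisors; [a = k = 0]
    gives the number of edges. *)
Definition cycsum a k (gT : finGroupType) (G : {group gT}) :=
  \sum_(K in cyclic_subgroups G | (primes_ge k).-nat #|K|) (a + omega #|K|).

(** Send [H] to the cyclic group [Y <*> H], whose p'-core recovers [H]. A nontrivial [Y] contributes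
    one prime, hence the shift [0 < i]. *)
Lemma cycsum_fiber (gT : finGroupType) (G Y : {group gT}) p i a : prime p ->
  Y \in level G p i ->
  cycsum (a + (0 < i)) p.+1 'C_G(Y)%G <=
    \sum_(K in cyclic_subgroups G | (primes_ge p).-nat #|K| && ('O_p(K)%G == Y))
       (a + omega #|K|).
Proof.
move=> p_pr /levelP[sYG cycY oY]; have p_gt1 := prime_gt1 p_pr.
pose h (H : {group gT}) := (Y <*> H)%G.
have pi_p' (H : {group gT}) : (primes_ge p.+1).-nat #|H| -> p^'.-nat #|H|.
  by apply: sub_in_pnat => q _; rewrite !inE => lt_pq; rewrite neq_ltn lt_pq orbT.
have pY : p.-group Y by rewrite /pgroup oY pnatX pnat_id.
have hall (H : {group gT}) : H \in cyclic_subgroups 'C_G(Y) ->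
    (primes_ge p.+1).-nat #|H| ->
  [/\ h H \in cyclic_subgroups G, 'O_p(h H) = Y, 'O_p^'(h H) = H
    & #|h H| = #|Y| * #|H|].
  move=> /cyclic_subgroupsP[]; rewrite subsetI => /andP[sHG cYH] cycH /pi_p' p'H.
  have coYH : coprime #|Y| #|H| by apply: pnat_coprime p'H.
  have cycYH : cyclic (h H) by apply: cyclicY.
  have defYH : (Y * H)%g = h H by rewrite /= cent_joinEr.
  have abYH := cyclic_abelian cycYH.
  have [hallY hallH] := coprime_mulpG_Hall defYH pY p'H.
  split.
  - by apply/cyclic_subgroupsP; rewrite join_subG sYG.
  - by apply: normal_Hall_pcore => //; rewrite -sub_abelian_normal // joing_subl.
  - by apply: normal_Hall_pcore => //; rewrite -sub_abelian_normal // joing_subr.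
  - by rewrite -defYH coprime_cardMg.
apply: (leq_sum_inj_fin (h := h)) => [H1 H2 | H | H] /=.
- move=> /andP[C1 p1] /andP[C2 p2] eq_h; apply: group_inj.
  by have [_ _ <- _] := hall _ C1 p1; have [_ _ <- _] := hall _ C2 p2; rewrite eq_h.
- move=> /andP[CH pH]; have [-> defY _ ->] := hall _ CH pH; rewrite /=.
  rewrite -val_eqE /= defY eqxx andbT pnatM oY pnatX pnatE // inE leqnn /=.
  by apply: sub_in_pnat pH => q _; rewrite !inE; apply: ltnW.
move=> /andP[CH pH]; have [_ _ _ ->] := hall _ CH pH.
have coYH : coprime #|Y| #|H| by apply: pnat_coprime (pi_p' _ pH).
rewrite omega_mul ?cardG_gt0 // addnA leq_add2r leq_add2l oY.
by case: i oY => // i _; rewrite omega_pfactor.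
Qed.

Lemma cycsum_step (gT : finGroupType) (G : {group gT}) p a : prime p ->
  cycsum a p.+1 G +
    \sum_(i < logn p #|G|) \sum_(Y in level G p i.+1) cycsum a.+1 p.+1 'C_G(Y)%G
  <= cycsum a p G.
Proof.
move=> p_pr; set e := logn p #|G|.
pose X (Y : {group gT}) := \sum_(K in cyclic_subgroups G |
   (primes_ge p).-nat #|K| && ('O_p(K)%G == Y)) (a + omega #|K|).
apply: (@leq_trans (\sum_(i < e.+1) \sum_(Y in level G p i) X Y)).
  rewrite big_ord_recl /=; apply: leq_add.
    have levY : 1%G \in level G p 0.
      by apply/levelP; rewrite sub1G cyclic1 cards1.
    rewrite (bigD1 1%G) //=; apply: leq_trans (leq_addr _ _).
    have := cycsum_fiber a p_pr levY; rewrite addn0; apply: leq_trans.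
    by rewrite (_ : 'C_G(1)%G = G) //; apply/group_inj/setIidPl; rewrite centsC sub1G.
  apply: leq_sum => i _; apply: leq_sum => Y levY.
  by have := cycsum_fiber a p_pr levY; rewrite addn1.
(* Membership in a level becomes a 0-1 factor; after exchanging the sums, each [Y] counts at most
   once because it has a single order. *)
rewrite (eq_bigr (fun i : 'I_e.+1 => \sum_(Y : {group gT} |
    Y \in cyclic_subgroups G) (#|Y| == p ^ i) * X Y)); last first.
  move=> i _; rewrite big_mkcond [RHS]big_mkcond; apply: eq_bigr => Y _.
  by rewrite inE; case: (Y \in _); case: eqP; rewrite ?mul1n ?mul0n.
rewrite exchange_big /=.
apply: (@leq_trans (\sum_(Y : {group gT}) X Y)).
  rewrite [leqRHS](bigID (fun Y => Y \in cyclic_subgroups G)) /=.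
  apply: leq_trans (leq_addr _ _); apply: leq_sum => Y _.
  rewrite -big_distrl /= -[leqRHS]mul1n leq_mul2r; apply/orP; right.
  have [/existsP[i oY] | /existsPn noY] := boolP [exists i : 'I_e.+1, #|Y| == p ^ i].
    rewrite (bigD1 i) //= oY big1 // => j; apply: contraNeq.
    rewrite eqb0 negbK => /eqP oYj; apply/eqP/val_inj; apply/eqP.
    by rewrite -(eqn_exp2l _ _ (prime_gt1 p_pr)) -oYj.
  by rewrite big1 // => i _; apply/eqP; rewrite eqb0.
rewrite /cycsum [leqRHS](partition_big (fun K : {group gT} => 'O_p(K)%G) predT) //=.
by apply: leq_sum => Y _; apply: eq_leq; apply: eq_bigl => K; rewrite andbA.
Qed.

Lemma primes_geS_in k n : ~~ prime k ->
  {in \pi(n), primes_ge k =i primes_ge k.+1}.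
Proof.
move=> k_npr q; rewrite mem_primes => /andP[q_pr _]; rewrite !inE.
by rewrite leq_eqVlt; case: eqP k_npr => // ->; rewrite q_pr.
Qed.

Lemma partn_primes_ge p n : prime p -> 0 < n ->
  n`_(primes_ge p) = p ^ logn p n * n`_(primes_ge p.+1).
Proof.
move=> p_pr n_gt0; rewrite -[LHS](partnC p) ?part_gt0 //.
rewrite partn_part => [|q]; last by rewrite !inE => /eqP->.
rewrite p_part -partnI; congr (_ * _); apply: eq_partn => q.
by rewrite !inE ltn_neqAle andbC eq_sym.
Qed.

(** Induction with [k] increasing, for all [a] and [G] at once, since centralizers with offset
    [a.+1] replace [G]. For prime [k] the bound chains [divsum_pfactor_mul], [levels_weight], the
    induction hypotheses and [cycsum_step]; the second claim follows equality back through this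
    chain. *)
Lemma cycsum_ge (gT : finGroupType) (G : {group gT}) a k :
  nilpotent G \/ odd #|G| ->
  divsum a #|G|`_(primes_ge k) <= cycsum a k G /\
  (cycsum a k G <= divsum a #|G|`_(primes_ge k) ->
     exists2 K : {group gT}, K \in cyclic_subgroups G
       & #|K| = #|G|`_(primes_ge k)).
Proof.
have [d] := ubnP (#|G|.+1 - k).
elim: d a k gT G => [//|d IHd] a k gT G lt_d hG.
have [lt_Gk | le_kG] := ltnP #|G| k.
  have -> : #|G|`_(primes_ge k) = 1.
    apply: part_p'nat; apply/pnatP => // q q_pr dv_q.
    by rewrite !inE -ltnNge (leq_ltn_trans _ lt_Gk) // dvdn_leq.
  have G1 : 1%G \in cyclic_subgroups G.
    by apply/cyclic_subgroupsP; rewrite sub1G cyclic1.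
  split=> [|_]; last by exists 1%G; rewrite ?cards1.
  rewrite /divsum unlock /= /cycsum (bigD1 1%G) /= ?cards1 ?G1 //.
  by rewrite addn0 leq_addr.
have [k_pr | k_npr] := boolP (prime k); last first.
  have <- : cycsum a k.+1 G = cycsum a k G.
    apply: eq_bigl => K; congr (_ && _); apply/esym/eq_in_pnat.
    exact: primes_geS_in.
  by rewrite (eq_in_partn (primes_geS_in k_npr)); apply: IHd => //; lia.
rewrite (partn_primes_ge k_pr) //; set p := k in k_pr *.
have hC Y : nilpotent 'C_G(Y) \/ odd #|'C_G(Y)|.
  case: hG => [nilG | oddG]; [left | right].
    by apply: nilpotentS nilG; apply: subsetIl.
  by apply: oddSg oddG; apply: subsetIl.
have lt_d' : #|G|.+1 - p.+1 < d by move: lt_d le_kG; rewrite /p; lia.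
have [IH1 IH2] := IHd a p.+1 gT G lt_d' hG.
have ltC (Y : {group gT}) : #|'C_G(Y)|.+1 - p.+1 < d.
  have := subset_leq_card (subsetIl G 'C(Y)); rewrite -/p in lt_d le_kG.
  by move: #|'C_G(Y)| #|G| lt_d le_kG => x y; lia.
have IHC (Y : {group gT}) := IHd a.+1 p.+1 gT 'C_G(Y)%G (ltC Y) (hC Y).
have step := cycsum_step G a k_pr.
set e := logn p #|G| in step *; set N := #|G|`_(primes_ge p.+1) in IH1 IH2 *.
have le_divsum := divsum_pfactor_mul a e k_pr (part_gt0 (primes_ge p.+1) #|G| : 0 < N).
have [le_levels eq_levels] := levels_weight hG k_pr (ltn0Sn a).
pose L i := \sum_(Y in level G p i) divsum a.+1 #|'C_G(Y)|`_(primes_ge p.+1).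
pose X i := \sum_(Y in level G p i) cycsum a.+1 p.+1 'C_G(Y)%G.
have le_LX i : L i <= X i by apply: leq_sum => Y _; have [] := IHC Y.
have le_sLX : \sum_(i < e) L i.+1 <= \sum_(i < e) X i.+1 by apply: leq_sum.
rewrite -/e -/N in le_levels eq_levels.
change (is_true (e * divsum a.+1 N <= \sum_(i < e) L i.+1)) in le_levels.
change (is_true (cycsum a p.+1 G + \sum_(i < e) X i.+1 <= cycsum a p G)) in step.
split=> [|le_cycsum].
  apply: leq_trans le_divsum (leq_trans (leq_add IH1 _) step).
  exact: leq_trans le_levels le_sLX.
have le_all := leq_trans step (leq_trans le_cycsum le_divsum).
have [e0 | e_gt0] := posnP e.
  rewrite e0 mul1n; apply: IH2; move: le_all; rewrite e0 big_ord0 /= mul0n !addn0 //.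
have le_X : \sum_(i < e) X i.+1 <= e * divsum a.+1 N by move: le_all; lia.
have [Y levY oCY] := eq_levels (leq_trans le_sLX le_X) e_gt0.
(* As [L i <= X i] at every level and the totals agree, [X] and [L] agree at the top level, and then
   at its member [Y], to which the equality case of the induction applies. *)
have le_Xe : X e <= L e.
  have sumE F : \sum_(i < e) F i.+1 = \sum_(i < e.-1) F i.+1 + F e.
    by rewrite -[in LHS](prednK e_gt0) big_ord_recr /= prednK.
  have le_s : \sum_(i < e.-1) L i.+1 <= \sum_(i < e.-1) X i.+1 by apply: leq_sum.
  have := leq_trans le_X le_levels; rewrite !sumE => le_XL.
  rewrite -(leq_add2l (\sum_(i < e.-1) L i.+1)); apply: leq_trans le_XL.
  by rewrite leq_add2r.
have le_Y : cycsum a.+1 p.+1 'C_G(Y)%G <= divsum a.+1 #|'C_G(Y)|`_(primes_ge p.+1).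
  move: le_Xe; rewrite /X /L (bigD1 Y) //= [leqRHS](bigD1 Y) //=.
  set rX := bigop.body _ _ _; set rL := bigop.body _ _ _.
  move=> le_XL; rewrite -(leq_add2r rL); apply: leq_trans le_XL; rewrite leq_add2l.
  by apply: leq_sum => Z _; have [] := IHC Z.
have [K CK oK] := (IHC Y).2 le_Y.
have /cyclic_subgroupsP[] := CK; rewrite subsetI => /andP[sKG cYK] cycK.
have [sYG cycY oY] := levelP _ _ _ _ levY.
have coYK : coprime #|Y| #|K|.
  rewrite oY oK oCY coprimeXl // prime_coprime //.
  apply/negP => dv_p; have : p \in primes_ge p.+1.
    exact: (pnatP _ (part_gt0 _ _) (part_pnat _ #|G|)).
  by rewrite inE /= ltnn.
exists (Y <*> K)%G; first by apply/cyclic_subgroupsP; rewrite join_subG sYG cyclicY.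
by rewrite /= cent_joinEr // coprime_cardMg // oY oK oCY.
Qed.

(** * Counting the edges of the cyclic subgroup graph *)

Lemma card_cyclic_covers (gT : finGroupType) (G K : {group gT}) :
  K \in cyclic_subgroups G -> #|[set H | cyclic_cover G H K]| = omega #|K|.
Proof.
move=> GK; have /cyclic_subgroupsP[sKG cycK] := GK.
have subK (H : {group gT}) : H \subset K -> H \in cyclic_subgroups G.
  move=> sHK; apply/cyclic_subgroupsP.
  by rewrite (subset_trans sHK) // (cyclicS sHK).
have maxK q : prime q -> q %| #|K| ->
    exists2 L : {group gT}, L \subset K & #|K| = #|L| * q.
  case/cyclicP: (cycK) => x defK q_pr dv_q; exists <[x ^+ q]>%G.
    by rewrite defK /= cycle_subG mem_cycle.
  by rewrite -orderE orderXdiv ?orderE -?defK // divnK.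
(* In a cyclic group containment is divisibility of orders, so a proper subgroup lies in some [L] of
   prime index, and a maximal one equals it. *)
have cover_index (H : {group gT}) :
  cyclic_cover G H K = (H \subset K) && prime #|K : H|.
  apply/and4P/andP => [[_ _ /andP[sHK nsKH] /existsPn noL] | [sHK i_pr]].
    split=> //; have i_gt1 : 1 < #|K : H| by rewrite indexg_gt1.
    have [|L sLK oK] := maxK _ (pdiv_prime i_gt1).
      by apply: dvdn_trans (pdiv_dvd _) (dvdn_indexg _ _).
    set q := pdiv _ in oK; have q_pr : prime q by apply: pdiv_prime.
    have sHL : H \subset L.
      rewrite -(cardSg_cyclic cycK) // -(dvdn_pmul2r (prime_gt0 q_pr)) -oK.
      by rewrite -(Lagrange sHK) dvdn_pmul2l ?cardG_gt0 // pdiv_dvd.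
    have := noL L; rewrite subK // !properE sHL sLK /=.
    have -> : ~~ (K \subset L).
      apply: contraTN (prime_gt1 q_pr) => /subset_leq_card.
      by rewrite oK -leqNgt -{2}[#|L|]muln1 leq_pmul2l ?cardG_gt0.
    rewrite andbT negbK => sLH; have eqHL : #|H| = #|L|.
      by apply/eqP; rewrite eqn_leq !subset_leq_card.
    by rewrite -divgS // eqHL oK mulKn ?cardG_gt0.
  split; rewrite ?subK //; first by rewrite properE sHK -indexg_gt1 prime_gt1.
  apply/existsPn => L; apply/negP => /and3P[_ /andP[sHL nsLH] /andP[sLK nsKL]].
  have iK := Lagrange_index sLK sHL.
  have : #|L : H| %| #|K : H| by rewrite -iK dvdn_mull.
  have LH_gt1 : 1 < #|L : H| by rewrite indexg_gt1.
  have KL_gt1 : 1 < #|K : L| by rewrite indexg_gt1.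
  by move/(proj2 (primeP i_pr))/orP; rewrite -iK => -[]/eqP; nia.
set S := [set H | _]; have sSK H : H \in S -> H \subset K.
  by rewrite inE cover_index => /andP[].
(* The index matches the maximal subgroups of [K] with the primes dividing its order. *)
rewrite cardE -(size_map (fun H : {group gT} => #|K : H|)); apply/perm_size.
apply: uniq_perm; rewrite ?primes_uniq //.
  rewrite map_inj_in_uniq ?enum_uniq // => H L; rewrite !mem_enum => /sSK sHK /sSK sLK.
  move=> eq_i; apply/group_inj/eqP; rewrite (eq_subG_cyclic cycK) //.
  rewrite -(eqn_pmul2r (indexg_gt0 K H)) Lagrange // eq_i Lagrange //.
move=> q; rewrite mem_primes cardG_gt0 /=; apply/mapP/andP.
  move=> [H]; rewrite mem_enum inE cover_index => /andP[_ i_pr] ->.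
  by rewrite i_pr dvdn_indexg.
move=> [q_pr dv_q]; have [L sLK oK] := maxK q q_pr dv_q.
have iL : #|K : L| = q by rewrite -divgS // oK mulKn ?cardG_gt0.
by exists L; rewrite // mem_enum inE cover_index sLK iL.
Qed.

Lemma card_cyclic_edges (gT : finGroupType) (G : {group gT}) :
  #|cyclic_edges G| = \sum_(K in cyclic_subgroups G) omega #|K|.
Proof.
pose V := [set HK : {group gT} * {group gT} | cyclic_cover G HK.1 HK.2].
have -> : cyclic_edges G = (fun HK => [set HK.1; HK.2]) @: V.
  apply/setP=> E; apply/imset2P/imsetP => [[H K] | [[H K]]].
    rewrite inE => GH /andP[GK /orP[]] covHK ->; first by exists (H, K); rewrite ?inE.
    by exists (K, H); rewrite ?inE //= setUC.
  rewrite inE /= => covHK ->; have /and4P[GH GK _ _] := covHK.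
  by exists H K; rewrite // inE GK /cyclic_adj covHK.
rewrite card_in_imset.
  rewrite -sum1_card (partition_big snd (mem (cyclic_subgroups G))) /=; last first.
    by move=> HK; rewrite inE => /and4P[].
  apply: eq_bigr => K GK; rewrite -(card_cyclic_covers GK) -sum1_card.
  rewrite (reindex_onto (fun H => (H, K)) fst) /=; last first.
    by move=> [H L] /= /andP[_ /eqP->].
  by apply: eq_bigl => H; rewrite !inE /= !eqxx !andbT.
(* An edge determines which end is the larger: exchanged ends would give a strict inclusion of a
   subgroup in itself. *)
move=> [H K] [H' K']; rewrite !inE /=.
move=> /and4P[_ _ ltHK _] /and4P[_ _ ltHK' _] /setP eqE.
have := eqE H; have := eqE K; have := eqE H'; have := eqE K'.
rewrite !inE !eqxx ?orbT /= => eK' eH' /esym eK /esym eH.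
case/orP: eH => /eqP eH; case/orP: eK => /eqP eK; subst.
- by rewrite properxx in ltHK.
- by [].
- by have := proper_trans ltHK ltHK'; rewrite properxx.
- by rewrite properxx in ltHK.
Qed.

Lemma card_cyclic_edges_cycsum (gT : finGroupType) (G : {group gT}) :
  #|cyclic_edges G| = cycsum 0 0 G.
Proof.
rewrite card_cyclic_edges; apply: eq_bigl => K.
rewrite (_ : (primes_ge 0).-nat #|K|) ?andbT //.
by apply/pnatP => // q _ _; rewrite inE.
Qed.

(** A subgroup of a cyclic group is determined by its order. The reverse inequality comes from
    [card_cyclic_edges_ge], cyclic groups being nilpotent. *)
Lemma card_cyclic_edges_cyclic_le (gT : finGroupType) (G : {group gT}) :
  cyclic G -> #|cyclic_edges G| <= divsum 0 #|G|.
Proof.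
move=> cycG; rewrite card_cyclic_edges -big_enum /=.
apply: (leq_sum_inj (h := fun K : {group gT} => #|K|)).
- exact: enum_uniq.
- exact: divisors_uniq.
- move=> H K; rewrite !mem_enum => /cyclic_subgroupsP[sHG _].
  move=> /cyclic_subgroupsP[sKG _] eqHK; apply/group_inj/eqP.
  by rewrite (eq_subG_cyclic cycG) // eqHK.
- move=> H; rewrite mem_enum => /cyclic_subgroupsP[sHG _].
  by rewrite -dvdn_divisors ?cardSg.
- by move=> H _; rewrite add0n.
Qed.

Lemma card_cyclic_edges_ge (gT : finGroupType) (G : {group gT}) :
  nilpotent G \/ odd #|G| ->
  divsum 0 #|G| <= #|cyclic_edges G| /\
  (#|cyclic_edges G| <= divsum 0 #|G| -> cyclic G).
Proof.
move=> hG; have [] := cycsum_ge 0 0 hG; rewrite -card_cyclic_edges_cycsum.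
rewrite part_pnat_id; last by apply/pnatP => // q _ _; rewrite inE.
move=> le_E eq_E; split=> // /eq_E[K /cyclic_subgroupsP[sKG cycK] oK].
suffices <- : K :=: G by [].
by apply/eqP; rewrite eqEcard sKG oK leqnn.
Qed.

Lemma cyclic_Zp n : cyclic (Zp n).
Proof.
rewrite /Zp; case: ifP => _; last exact: cyclic1.
by apply/cyclicP; exists Zp1; apply: Zp_cycle.
Qed.

(* [Zp n] is a group of order n for every n > 0, including n = 1 (where it is
   the trivial subgroup of 'Z_1), unlike the full type 'Z_n. *)
Theorem theorem1p1 (gT : finGroupType) (G : {group gT}) (n : nat)
    (oG : #|G| = n) (hG : nilpotent G \/ odd n) :
  #|cyclic_edges (Zp_group n)| <= #|cyclic_edges G| /\
  (#|cyclic_edges G| = #|cyclic_edges (Zp_group n)| <-> (G \isog Zp n)%g).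
Proof.
have oZ : #|Zp n| = n by rewrite card_Zp // -oG cardG_gt0.
have cycZ := cyclic_Zp n.
have nilZ : nilpotent (Zp_group n) by apply/abelian_nil/cyclic_abelian.
have [geZ _] := card_cyclic_edges_ge (or_introl nilZ : _ \/ odd #|Zp_group n|).
have := card_cyclic_edges_cyclic_le cycZ; rewrite /= oZ in geZ * => leZ.
have -> : #|cyclic_edges (Zp_group n)| = divsum 0 n.
  by apply/eqP; rewrite eqn_leq leZ.
rewrite -oG in hG; have [geG eqG] := card_cyclic_edges_ge hG.
rewrite oG in geG eqG; split=> //; split=> [eG | isoG].
  by rewrite (isog_cyclic_card _ (eqG _)) ?eG // cycZ oZ oG /=.
apply/eqP; rewrite eqn_leq geG andbT -oG.
by apply: card_cyclic_edges_cyclic_le; rewrite (isog_cyclic isoG).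
Qed.
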